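(* Let $G$ be a countable, discrete group. Then every $\delta$-stable ultrafilter on $G$, regarded as a point of $\beta G$, is non-recurrent in $\beta G$.
   Context: Points of the Stone-Cech compactification $\beta G$ are identified with ultrafilters on $G$. Left multiplication $g_1\mapsto gg_1$ extends to a homeomorphism of $\beta G$, written $\omega\mapsto g\cdot\omega$, giving an action of $G$ on $\beta G$. An ultrafilter on a countable set $N$ is $\delta$-stable if for each partition $N=\bigcup_iP_i$ into sets of arbitrary sizes, either one of the $P_i$ is in the ultrafilter or there exists a set $B$ in the ultrafilter such that $B\cap P_i$ is finite for every $i$. A point $\omega\in\beta G$ is non-recurrent if there is an open neighborhood $U$ of $\omega$ in $\beta G$ such that $g\cdot\omega\notin U$ for all $g\in G$ with $g\neq1$, where $1$ is the identity of $G$. *)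

(* Defs.v *)
From HB Require Import structures.
From mathcomp Require Import all_boot.
From mathcomp Require Import boolp classical_sets functions cardinality filter.
From mathcomp Require Import topology.

Set Implicit Arguments.
Unset Strict Implicit.
Unset Printing Implicit Defensive.

Local Open Scope classical_set_scope.

(** The Stone-Cech compactification of a discrete space [T], realized as the
    space of ultrafilters on [T]. The name is justified by [eta_inj], [open_eta],
    [eta_dense], [beta_compact], [beta_hausdorff] and [beta_universal] below. *)
Record beta (T : Type) := Beta {
  beta_sets :> set_system T;
  beta_ultra : UltraFilter beta_sets
}.
#[global] Existing Instance beta_ultra.

HB.instance Definition _ (T : Type) := Choice.copy (beta T) {classic beta T}.

Lemma fmap_ultra (S T : Type) (f : S -> T) (F : set_system S) :
  UltraFilter F -> UltraFilter (fmap f F).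
Proof.
move=> FU; split=> [|H HF FH]; first exact: fmap_proper_filter.
apply/seteqP; split=> // A HA.
have [//|FNA] := in_ultra_setVsetC (f @^-1` A) FU.
have HNA : H (~` A) by exact: FH.
by have [x []] := filter_ex (filterI HA HNA).
Qed.

Section BetaTopology.
Variable T : Type.
Implicit Types (w : beta T) (A B : set T).

Lemma beta_eq w1 w2 : beta_sets w1 = beta_sets w2 -> w1 = w2.
Proof.
case: w1 w2 => [F1 U1] [F2 U2] /= F12; rewrite F12 in U1 *.
by congr Beta; exact: Prop_irrelevance.
Qed.

Definition beta_basic A : set (beta T) := [set w : beta T | beta_sets w A].

Let beta_cover : \bigcup_(A in [set: set T]) beta_basic A = setT.
Proof. by apply/seteqP; split=> // w _; exists setT => //; exact: filterT. Qed.

Let beta_join A B w : [set: set T] A -> [set: set T] B ->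
  beta_basic A w -> beta_basic B w ->
  exists C, [/\ [set: set T] C, beta_basic C w &
                beta_basic C `<=` beta_basic A `&` beta_basic B].
Proof.
move=> _ _ wA wB; exists (A `&` B); split=> //; first exact: filterI.
by move=> v vAB; split; apply: filterS vAB => x [].
Qed.

HB.instance Definition _ := isBaseTopological.Build (beta T)
  beta_cover beta_join.

Lemma open_beta_basic A : open (beta_basic A).
Proof. by exists [set A] => //; rewrite bigcup_set1. Qed.

Lemma nbhs_betaP w (U : set (beta T)) :
  nbhs w U <-> exists2 A, beta_sets w A & beta_basic A `<=` U.
Proof.
rewrite nbhsE; split=> [[V [[D _ <-] [A DA wA]] sVU]|[A wA sAU]].
  by exists A => // v vA; apply: sVU; exists A.
by exists (beta_basic A) => //; split=> //; exact: open_beta_basic.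
Qed.

Definition eta (x : T) : beta T := Beta (principal_filter_ultra x).

Lemma etaE x A : beta_sets (eta x) A <-> A x.
Proof. exact: principal_filterP. Qed.

Lemma beta_hausdorff : hausdorff_space (beta T).
Proof.
move=> v w vw; apply: beta_eq.
apply: (@max_filter _ _ (beta_ultra w)) => A wA.
have [//|vNA] := in_ultra_setVsetC A (beta_ultra v).
have [u [uNA uA]] : beta_basic (~` A) `&` beta_basic A !=set0.
  by apply: vw; apply/nbhs_betaP; [exists (~` A)|exists A].
by have [x []] := filter_ex (filterI uA uNA).
Qed.

Lemma beta_compact : compact [set: beta T].
Proof.
rewrite compact_ultra => F FU _.
pose E := [set A | F (beta_basic A)].
have EF : ProperFilter E.
  apply: Build_ProperFilter_ex; first move=> A EA.
    by have [w wA] := filter_ex (EA : F _); exact: filter_ex wA.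
  split=> [|A B EA EB|A B AB].
  - by apply: (@filterS _ F _ setT) filterT => w _; exact: filterT.
  - apply: (@filterS _ F _ _ _ _ (@filterI _ F _ _ _ EA EB)) => w [wA wB].
    exact: filterI.
  - by apply: (@filterS _ F) => w; exact: filterS.
have EU : UltraFilter E.
  split=> // H HF EH; apply/seteqP; split=> // A HA.
  have [//|FNA] := in_ultra_setVsetC (beta_basic A) FU.
  suff /EH HNA : E (~` A) by have [x []] := filter_ex (filterI HA HNA).
  apply: (@filterS _ F _ _ _ _ FNA) => w /= NwA.
  by have [] := in_ultra_setVsetC A (beta_ultra w).
exists (Beta EU); split=> // U /nbhs_betaP[A EA AU].
exact: (@filterS _ F _ _ _ AU EA).
Qed.

Lemma eta_inj : injective eta.
Proof.
move=> x y xy; have : beta_sets (eta x) [set y] by rewrite xy; exact/etaE.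
by move=> /etaE.
Qed.

Lemma open_eta x : open [set eta x].
Proof.
have -> : [set eta x] = beta_basic [set x]; last exact: open_beta_basic.
apply/seteqP; split=> [_ ->|w wx]; first exact/etaE.
apply/beta_eq/(@max_filter _ _ (beta_ultra (eta x))) => A /etaE Ax.
by apply: (@filterS _ (beta_sets w) _ _ _ _ wx) => _ ->.
Qed.

Lemma eta_dense : dense (range eta).
Proof.
move=> U [w Uw] oU; have /nbhs_betaP[A wA AU] : nbhs w U by exact: open_nbhs_nbhs.
have [x Ax] := filter_ex wA.
by exists (eta x); split; [apply/AU/etaE|exists x].
Qed.

Lemma beta_universal (K : topologicalType) (f : T -> K) :
  compact [set: K] -> hausdorff_space K ->
  exists! F : beta T -> K, continuous F /\ F \o eta = f.
Proof.
move=> cK hK.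
have cvg_f w : exists p : K, fmap f w --> p.
  have := cK; rewrite compact_ultra.
  by move=> /(_ _ (fmap_ultra f (beta_ultra w)) filterT)[p [_ wp]]; exists p.
have [F fF] := boolp.choice cvg_f.
have F_unique (H : beta T -> K) : continuous H -> H \o eta = f -> F = H.
  move=> cH Hf; apply/funext => w; apply: hK => V U VFw /cH/nbhs_betaP[A wA AU].
  have [x [Vfx Ax]] := filter_ex (@filterI _ w _ (f @^-1` V) _ (fF w V VFw) wA).
  exists (f x); split=> //; rewrite -Hf.
  by apply: AU; apply/etaE.
exists F; split=> [|H [cH Hf]]; last exact: F_unique.
split.
  move=> w U /(compact_regular hK cK filterT)[V VFw VU].
  apply/nbhs_betaP; exists (f @^-1` V); first exact: fF.
  move=> v vV; apply: VU => W /fF vW.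
  have [x [Vx Wx]] := filter_ex (@filterI _ v _ (f @^-1` V) (f @^-1` W) vV vW).
  by exists (f x).
apply/funext => x; apply: hK => V U /fF/etaE Vfx /nbhs_singleton Ufx.
by exists (f x).
Qed.

End BetaTopology.

Definition beta_map (S T : Type) (f : S -> T) (w : beta S) : beta T :=
  Beta (fmap_ultra f (beta_ultra w)).

Lemma beta_map_eta (S T : Type) (f : S -> T) :
  beta_map f \o @eta S = @eta T \o f.
Proof.
apply/funext => x; apply/beta_eq/funext => A; apply/propext.
by split=> /principal_filterP fxA; apply/principal_filterP.
Qed.

Lemma beta_map_continuous (S T : Type) (f : S -> T) : continuous (beta_map f).
Proof.
move=> w U /nbhs_betaP[A wA AU]; apply/nbhs_betaP.
by exists (f @^-1` A) => // v vA; exact: AU.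
Qed.

(** A partition is given as its set [P] of (nonempty) blocks. Principal
    ultrafilters are delta-stable in this sense. *)
Definition delta_stable (N : Type) (w : set_system N) :=
  forall P : set (set N), partition P id [set: N] ->
    (exists2 A, P A & w A) \/
    (exists2 B, w B & forall A, P A -> finite_set (B `&` A)).

Section Action.
Variable G : groupType.
Implicit Types (g : G) (w : beta G).

(** [beta_act g w] contains [A] iff [w] contains [{x | g x \in A}]; it is the
    only continuous extension of left multiplication by [g], cf. [beta_act_eta],
    [beta_act_continuous] and [beta_universal]. *)
Definition beta_act g : beta G -> beta G := beta_map (fun x : G => (g * x)%g).

Lemma beta_act_eta g x : beta_act g (eta x) = eta (g * x)%g.
Proof. exact: (congr1 (@^~ x) (beta_map_eta (fun x : G => (g * x)%g))). Qed.

Lemma beta_act_continuous g : continuous (beta_act g).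
Proof. exact: beta_map_continuous. Qed.

Lemma beta_act1 w : beta_act 1%g w = w.
Proof.
apply/beta_eq/funext => A /=; congr (beta_sets w _).
by apply/funext => x /=; rewrite mul1g.
Qed.

Lemma beta_actM g h w : beta_act (g * h)%g w = beta_act g (beta_act h w).
Proof.
apply/beta_eq/funext => A /=; congr (beta_sets w _).
by apply/funext => x /=; rewrite mulgA.
Qed.

Definition non_recurrent w :=
  exists2 U : set (beta G), open_nbhs w U &
    forall g, g <> 1%g -> ~ U (beta_act g w).

End Action.

(* Main.v *)
Require Import Defs.
From mathcomp Require Import all_boot.
From mathcomp Require Import finmap.
From mathcomp Require Import boolp classical_sets functions cardinality filter.
From mathcomp Require Import topology.

Local Open Scope classical_set_scope.

(** A set [B] of [w] gives a neighborhood of [w] that misses every [g . w] with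
    [g <> 1] as soon as, for each such [g], the set of the [x] in [B] with [g x]
    in [B] is not in [w]. If [w] is principal, take [B] to be a singleton of [w].

    Otherwise [w] contains no finite set, so it suffices that [B] contain only
    finitely many [x] with [g x] in [B]. For a single [g <> 1], left
    multiplication by [g] is injective without fixed point, and [w] has a member
    [A_g] that is even disjoint from its translate [g A_g]
    ([ultra_disjoint_image]). There are countably many [g], so delta-stability
    yields one [B] in [w] almost contained in all the [A_g]
    ([delta_stable_pseudo_intersection]). If [x] and [g x] are in [B], then one
    of the two is in the finite set [B `\` A_g]; this leaves finitely many
    [x]. *)

Lemma ultra_finite_set1 (T : choiceType) (w : set_system T) (A : set T) :
  UltraFilter w -> finite_set A -> w A -> exists x, w [set x].
Proof.
move=> wU /finite_fsetP[X ->] wX; apply/not_existsP => w1.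
have : w (\bigcap_(x in [set` X]) ~` [set x]).
  apply: filter_bigI => x _.
  by have [/w1|] := in_ultra_setVsetC [set x] wU.
by move=> /(filterI wX)/filter_ex[x [Xx /(_ x Xx)]]; exact.
Qed.

(** By Zorn there is a maximal [A] disjoint from its preimage. A point [x]
    outside [A] cannot be added to it, so that [f x] is in [A] or [x] is the image
    of a point of [A]. Hence [A], its preimage and its image cover [T], and [w]
    contains one of these three sets. All three are disjoint from their
    preimages, the image because [f] is injective. *)
Lemma ultra_disjoint_image {T : Type} (w : set_system T) (f : T -> T) :
  UltraFilter w -> injective f -> (forall x, f x <> x) ->
  exists2 A, w A & forall x, A x -> ~ A (f x).
Proof.
move=> wU f_inj f_nfix.
pose P (A : set T) := forall x, A x -> ~ A (f x).
have [F FP Ftot|A [PA Amax]] := @Zorn_bigcup T P.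
  move=> x [X FX Xx] [Y FY Yfx].
  have [XY|YX] := Ftot X Y FX FY.
    by apply: (FP Y FY x) => //; exact: XY.
  by apply: (FP X FX x) => //; exact: YX.
have covA x : ~ A x -> ~ A (f x) -> (f @` A) x.
  move=> NAx NAfx; apply: contrapT => Nfx.
  apply: (Amax (x |` A)); first by split=> [y|/(_ x (or_introl erefl))//]; right.
  move=> y [->|Ay] [fy|Afy] //; first exact: f_nfix fy.
    by apply: Nfx; exists y.
  exact: PA Afy.
have [wA|wNA] := in_ultra_setVsetC A wU; first by exists A.
have [wfA|wNfA] := in_ultra_setVsetC (f @^-1` A) wU.
  by exists (f @^-1` A) => // x; exact: PA.
exists (f @` A).
  by apply: filterS (filterI wNA wNfA) => x [NAx NAfx]; exact: covA.
by move=> _ [y Ay <-] [z Az /f_inj zfy]; apply: (PA y Ay); rewrite -zfy.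
Qed.

Lemma delta_stable_fibers {N I : Type} (w : set_system N) (f : N -> I) :
  delta_stable w ->
  (exists i, w (f @^-1` [set i])) \/
  (exists2 B, w B & forall i, finite_set (B `&` f @^-1` [set i])).
Proof.
move=> /(_ (range (fun x => f @^-1` [set f x])))[].
- split=> [|_ _ [x _ <-] [y _ <-] [z [/= <- <-]]//|_ [x _ <-]].
    by apply/seteqP; split=> // x _; exists (f @^-1` [set f x]) => //; exists x.
  by exists x.
- by move=> [_ [x _ <-] wx]; left; exists (f x).
- move=> [B wB Bfin]; right; exists B => // i.
  have [[x <-]|Ni] := pselect (exists x, f x = i).
    by apply: Bfin; exists x.
  suff -> : B `&` f @^-1` [set i] = set0 by exact: finite_set0.
  by apply/seteqP; split=> // x [_ fx]; apply: Ni; exists x.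
Qed.

(** Partition [N] by the least [n] such that [A n] misses [x] ([None] when [x]
    is in all of them). The block of [Some n] is disjoint from [A n], so it is not
    in [w]; the block of [None] is the intersection of all [A n]. And if [B] meets
    every block in a finite set, then [B `\` A n] is finite, being covered by the
    blocks of [Some m] for [m <= n]. *)
Lemma delta_stable_pseudo_intersection {N : Type} (w : set_system N)
    (A : nat -> set N) :
  ProperFilter w -> delta_stable w -> (forall n, w (A n)) ->
  exists2 B, w B & forall n, finite_set (B `\` A n).
Proof.
move=> wF w_stable wA.
pose least_miss x (o : option nat) :=
  if o is Some n then ~ A n x /\ (forall m, ~ A m x -> n <= m)
  else forall n, A n x.
have /boolp.choice[f fP] : forall x, exists o, least_miss x o.
  move=> x.
  have [Ax|/existsNP[n0 NAx]] := pselect (forall n, A n x); first by exists None.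
  have exA : exists n, `[< ~ A n x >] by exists n0; exact/asboolP.
  exists (Some (ex_minn exA)); case: ex_minnP => n /asboolP NAn n_min.
  by split=> // m NAm; apply: n_min; exact/asboolP.
have [[[n|] wn]|[B wB Bfin]] := delta_stable_fibers w f w_stable.
- have [x [/= fx Ax]] := filter_ex (filterI wn (wA n)).
  by move: (fP x); rewrite fx => -[].
- exists (f @^-1` [set None]) => // n.
  suff -> : f @^-1` [set None] `\` A n = set0 by exact: finite_set0.
  by apply/seteqP; split=> // x [/= fx]; move: (fP x); rewrite fx => /(_ n).
- exists B => // n.
  apply: (@sub_finite_set _ _
    (\bigcup_(m in `I_n.+1) (B `&` f @^-1` [set Some m]))).
    move=> x [Bx NAx]; move: (fP x); case fx: (f x) => [m|]; last by move/(_ n).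
    by move=> [_ /(_ n NAx) mn]; exists m.
  by apply: bigcup_finite => [|m _]; [exact: finite_II|exact: Bfin].
Qed.

Lemma non_recurrent_set (G : groupType) (w : beta G) (B : set G) :
  beta_sets w B ->
  (forall g, g <> 1%g -> ~ beta_sets w (B `&` [set x | B (g * x)%g])) ->
  non_recurrent w.
Proof.
move=> wB NwB; exists (beta_basic B).
  by split=> //; exact: open_beta_basic.
by move=> g g1 wgB; apply: (NwB g g1); exact: filterI.
Qed.

Theorem proposition29 (G : groupType) (G_countable : countable [set: G])
    (w : beta G) (w_stable : delta_stable w) : non_recurrent w.
Proof.
have mulg_nfix (g : G) : g <> 1%g -> forall x, (g * x)%g <> x.
  by move=> g1 x gx; apply: g1; apply: (mulIg x); rewrite mul1g.
have [[a wa]|Nw1] := pselect (exists a, beta_sets w [set a]).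
  apply: (non_recurrent_set _ w [set a] wa) => g g1 wga.
  have [x [/= -> ga]] := filter_ex wga.
  exact: mulg_nfix ga.
have /countable_injP[e e_inj] := G_countable.
(* The [A_g] are indexed through the injection [e] of [G] into [nat]; for an [n]
   that is not the index of some [g <> 1], the whole group serves as [A n]. *)
have /boolp.choice[A AP] : forall n, exists A, beta_sets w A /\
    forall g, g <> 1%g -> e g = n -> forall x, A x -> ~ A (g * x)%g.
  move=> n.
  have [[g [g1 egn]]|Nn] := pselect (exists g, g <> 1%g /\ e g = n); last first.
    by exists setT; split=> [|g g1 egn]; [exact: filterT|case: Nn; exists g].
  have [A wA PA] := ultra_disjoint_image w (fun x => g * x)%g (beta_ultra w)
    (@mulgI G g) (mulg_nfix g g1).
  exists A; split=> // h _ ehn.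
  suff -> : h = g by [].
  by apply: e_inj; rewrite ?inE// ehn.
have [B wB Bfin] := delta_stable_pseudo_intersection w A _ w_stable
  (fun n => proj1 (AP n)).
apply: (non_recurrent_set _ w B wB) => g g1 wBg; apply: Nw1.
apply: ultra_finite_set1 wBg; have [_ /(_ g g1 erefl) AgP] := AP (e g).
apply: (@sub_finite_set _ _
  ((B `\` A (e g)) `|` (fun x => g * x)%g @^-1` (B `\` A (e g)))).
  move=> x [Bx Bgx]; have [Ax|NAx] := pselect (A (e g) x); last by left.
  by right; split=> //; exact: AgP.
rewrite finite_setU; split; first exact: Bfin.
by apply: finite_preimage; [move=> x y _ _; exact: mulgI|exact: Bfin].
Qed.
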